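(* Let $G$ be any group with a finite collection $\{\sigma_j\mid j=1,\ldots,n\}$ of pairwise non-isomorphic splittings. Suppose $\{\sigma_j\mid j=1,\ldots,n\}$ satisfies sandwiching. For each $j$, let $X_j$ be an $H_j$-almost invariant set arising from $\sigma_j$. Let $\Sigma:=\bigcup_{j=1}^n\Sigma(X_j)$. Then there exists an ultrafilter on $(\Sigma,\leq)$ satisfying the descending chain condition.
   Context: For $X\subset G$, $X^*=G\setminus X$, $\Sigma(X)=\{gX,gX^*\mid g\in G\}$, $\mathrm{Stab}(X)=\{g: gX=X\}$. A subset of $G$ is $H$-finite if it is contained in finitely many right cosets $Hg_i$. The corners of a pair $(A,B)$ are $A\cap B$, $A\cap B^*$, $A^*\cap B$, $A^*\cap B^*$. A $G$-tree is a simplicial tree with a simplicial $G$-action that inverts no edge. A splitting of $G$ is a $G$-tree $T$ with no global fixed point such that $G\backslash T$ has exactly one edge. Two splittings are isomorphic if their trees are $G$-equivariantly isomorphic. An $H$-almost invariant set arising from the splitting is a set $X=\{g\in G : e \text{ points away from } gv\}$, where $v$ is a vertex of $T$, $e$ is a directed edge of $T$, and $H=\mathrm{Stab}(e)=\mathrm{Stab}(X)$; ''$e$ points away from $gv$'' means that $gv$ lies in the component of $T$ minus the interior of $e$ containing the initial vertex of $e$. For $A,B\in\Sigma$, a corner of $(A,B)$ is small if it is $\mathrm{Stab}(A)$-finite (equivalently, here, $\mathrm{Stab}(B)$-finite); $A$ crosses $B$ if no corner is small. $A\leq B$ means that $A\cap B^*$ is empty or is the only small corner of $(A,B)$; since the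 $\sigma_j$ are pairwise non-isomorphic this is a partial order on $\Sigma$. Sandwiching: $X_j$ is sandwiched by $X_k$ if either there exist $A,B\in\Sigma(X_k)$ with $A\leq X_j\leq B$, or $X_j$ crosses every element of $\Sigma(X_k)$. $\{\sigma_j\}$ satisfies sandwiching if for all $j,k$, $X_j$ is sandwiched by $X_k$ (independent of the choice of the $X_j$). An ultrafilter on $(\Sigma,\leq)$ is a subset $V\subset\Sigma$ such that (1) for all $A\in\Sigma$, either $A\in V$ or $A^*\in V$ but not both; (2) if $A\in V$, $B\in\Sigma$ and $A\leq B$, then $B\in V$. It satisfies the descending chain condition if every chain $A_1\geq A_2\geq\cdots$ of elements of $V$ stabilizes after finitely many steps. *)

(* Defs.v *)
From mathcomp Require Import all_boot.
From mathcomp Require Import boolp classical_sets.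

Set Implicit Arguments.
Unset Strict Implicit.
Unset Printing Implicit Defensive.

Local Open Scope classical_set_scope.

(** The groups are arbitrary (possibly infinite) groups: [groupType] is the
    structure of mathcomp's [monoid.v], not [finGroupType]. *)

Section Subsets.
Variable G : groupType.
Implicit Types (g : G) (A B H V X Y Sigma : set G).

Definition ltrans g X : set G := [set (g * x)%g | x in X].

Definition stab X : set G := [set g | ltrans g X = X].

Definition translates X : set (set G) :=
  [set A | exists g, A = ltrans g X \/ A = ltrans g (~` X)].

Definition finite_over H X : Prop :=
  exists s : seq G, X `<=` [set x | exists h g, [/\ H h, g \in s & x = (h * g)%g]].

(** [small A Y] is meant for [Y] a corner of a pair [(A, B)]. *)
Definition small A Y : Prop := finite_over (stab A) Y.

Definition crosses A B : Prop :=
  [/\ ~ small A (A `&` B), ~ small A (A `&` ~` B),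
      ~ small A (~` A `&` B) & ~ small A (~` A `&` ~` B)].

Definition ai_le A B : Prop :=
  A `&` ~` B = set0 \/
  [/\ small A (A `&` ~` B), ~ small A (A `&` B),
      ~ small A (~` A `&` B) & ~ small A (~` A `&` ~` B)].

Definition sandwiched X Y : Prop :=
  (exists A B, [/\ translates Y A, translates Y B, ai_le A X & ai_le X B]) \/
  (forall A, translates Y A -> crosses X A).

Definition satisfies_sandwiching (I : Type) (X : I -> set G) : Prop :=
  forall j k, sandwiched (X j) (X k).

(** Ultrafilters here are those of a poset with complementation, not the
    set-theoretic ultrafilters of mathcomp-analysis. *)
Definition ultrafilter_on (Sigma : set (set G)) (le : set G -> set G -> Prop)
    (V : set (set G)) : Prop :=
  [/\ V `<=` Sigma,
      forall A, Sigma A -> (V A \/ V (~` A)) /\ ~ (V A /\ V (~` A)) &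
      forall A B, V A -> Sigma B -> le A B -> V B].

Definition descending_chain_condition (le : set G -> set G -> Prop)
    (V : set (set G)) : Prop :=
  forall A : nat -> set G, (forall i, V (A i)) ->
    (forall i, le (A i.+1) (A i)) ->
    exists N, forall i, N <= i -> A i = A N.

End Subsets.

(** A simplicial tree is a simple graph (no loops or multiple edges) that is
    nonempty, connected and has no simple closed path of length at least 3.
    Taking the adjacency relation boolean is no restriction classically. *)
Record Gtree (G : groupType) := MkGtree {
  vertex : eqType;
  adj : rel vertex;
  tree_inhabited : inhabited vertex;
  adj_sym : symmetric adj;
  adj_irrefl : irreflexive adj;
  tree_connected : forall v w, exists2 p, path adj v p & last v p = w;
  tree_acyclic : forall c, ucycle adj c -> size c <= 2;
  gact : G -> vertex -> vertex;
  gact1 : forall v, gact 1%g v = v;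
  gactM : forall g h v, gact (g * h)%g v = gact g (gact h v);
  gact_adj : forall g v w, adj (gact g v) (gact g w) = adj v w;
  no_inversion : forall g v w, adj v w -> ~ (gact g v = w /\ gact g w = v)
}.
Arguments adj {G} g v w : rename.
Arguments gact {G} g g0 v : rename.

(** As no edge is inverted, a point in the interior of an edge that is fixed
    by a group element has both ends of the edge fixed too; hence a global
    fixed point exists iff there is a globally fixed vertex. *)
Definition has_global_fixed_point (G : groupType) (T : Gtree G) : Prop :=
  exists v : vertex T, forall g, gact T g v = v.

(** Edges of the quotient are orbits of unoriented edges. *)
Definition one_edge_orbit (G : groupType) (T : Gtree G) : Prop :=
  (exists v w, adj T v w) /\
  (forall v w v' w', adj T v w -> adj T v' w' ->
     exists g, (gact T g v = v' /\ gact T g w = w') \/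
               (gact T g v = w' /\ gact T g w = v')).

Record splitting (G : groupType) := MkSplitting {
  splitting_tree :> Gtree G;
  splitting_no_fixed_point : ~ has_global_fixed_point splitting_tree;
  splitting_one_edge : one_edge_orbit splitting_tree
}.

Definition isomorphic (G : groupType) (S T : Gtree G) : Prop :=
  exists f : vertex S -> vertex T,
    [/\ bijective f, forall v w, adj T (f v) (f w) = adj S v w &
        forall g v, f (gact S g v) = gact T g (f v)].

Section AlmostInvariant.
Variables (G : groupType) (T : Gtree G).

(** A directed edge is the pair (initial vertex, terminal vertex). *)
Definition adj_minus (e : vertex T * vertex T) : rel (vertex T) :=
  fun v w => [&& adj T v w, (v, w) != e & (w, v) != e].

Definition points_away (e : vertex T * vertex T) (w : vertex T) : Prop :=
  exists2 p, path (adj_minus e) e.1 p & last e.1 p = w.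

Definition edge_stab (e : vertex T * vertex T) : set G :=
  [set g | gact T g e.1 = e.1 /\ gact T g e.2 = e.2].

Definition almost_invariant_from (H X : set G) : Prop :=
  exists (v : vertex T) (e : vertex T * vertex T),
    [/\ adj T e.1 e.2, X = [set g | points_away e (gact T g v)],
        H = edge_stab e & H = stab X].

End AlmostInvariant.

(* Main.v *)
Require Import Defs.
From mathcomp Require Import all_boot.
From mathcomp Require Import boolp classical_sets.

(** Comparing [A] with [B] only needs that [A] and [B] are nontrivial almost
    invariant: smallness of corners is then independent of the stabilizer used,
    and [<=] is a partial order. For the sets arising from a splitting these
    properties and nestedness are read off the tree; nontriviality comes from a
    hyperbolic element [g] with [X] properly contained in [g X].

    The splittings are treated one after the other. Given an ultrafilter [V]
    for the first [k] of them, a translate [A] of [X_k] is chosen if it lies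
    above some element of [V], rejected if its complement does, and otherwise
    chosen iff it contains the identity. If a chain in the new ultrafilter lies
    in [Sigma(X_k)] infinitely often, then either the identity bounds it from
    below, or each term is above an element of [V], which may be taken minimal
    in some fixed [Sigma(X_j)]. Nestedness of [Sigma(X_j)] turns this into one
    lower bound for the whole chain, and sandwiching into a lower bound in
    [Sigma(X_k)], where intervals are finite. *)


Set Implicit Arguments.
Unset Strict Implicit.
Unset Printing Implicit Defensive.

Local Open Scope classical_set_scope.

Lemma infinitely_often (T : eqType) (s : seq T) (f : nat -> T) :
  (forall N, exists2 i, N <= i & f i \in s) ->
  exists C, C \in s /\ forall N, exists2 i, N <= i & f i = C.
Proof.
elim: s => [|x s IHs] fs; first by have [] := fs 0.
have [xio|/existsNP[M Mx]] := pselect (forall N, exists2 i, N <= i & f i = x).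
  by exists x; rewrite mem_head.
have [N|C [Cs Cio]] := IHs; last by exists C; rewrite in_cons Cs orbT.
have [i] := fs (maxn M N); rewrite geq_max in_cons => /andP[Mi Ni] /orP[/eqP fx|].
  by case: Mx; exists i.
by exists i.
Qed.

(** * Cosets, small sets and the order on almost invariant sets *)

Section Cosets.
Variable G : groupType.
Implicit Types (g x y : G) (A B C H K X Y : set G).

Lemma ltransE g X x : ltrans g X x = X (g^-1 * x)%g.
Proof.
apply/propext; split=> [[y Xy <-]|Xx]; first by rewrite mulKg.
by exists (g^-1 * x)%g; rewrite ?mulVKg.
Qed.

Lemma ltrans1 X : ltrans 1%g X = X.
Proof. by apply/funext => x; rewrite ltransE invg1 mul1g. Qed.

Lemma ltransM g h X : ltrans (g * h)%g X = ltrans g (ltrans h X).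
Proof. by apply/funext => x; rewrite !ltransE invgM mulgA. Qed.

Lemma ltransK g X : ltrans g^-1 (ltrans g X) = X.
Proof. by rewrite -ltransM mulVg ltrans1. Qed.

Lemma ltransVK g X : ltrans g (ltrans g^-1 X) = X.
Proof. by rewrite -ltransM mulgV ltrans1. Qed.

Lemma ltransC g X : ltrans g (~` X) = ~` ltrans g X.
Proof. by apply/funext => x; rewrite ltransE /setC /= ltransE. Qed.

Lemma ltransI g X Y : ltrans g (X `&` Y) = ltrans g X `&` ltrans g Y.
Proof. by apply/funext => x; rewrite ltransE /setI /= !ltransE. Qed.

Lemma ltransS g X Y : X `<=` Y -> ltrans g X `<=` ltrans g Y.
Proof. by move=> XY x; rewrite !ltransE; exact: XY. Qed.

Lemma stabC A : stab (~` A) = stab A.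
Proof.
apply/funext => g; rewrite /stab /= ltransC; apply/propext; split=> [|-> //].
by move=> /(congr1 setC); rewrite !setCK.
Qed.

Lemma stab_mem A h x : stab A h -> A (h * x)%g = A x.
Proof. by move=> {1}<-; rewrite ltransE mulKg. Qed.

Lemma stabV A h : stab A h -> stab A h^-1%g.
Proof. by rewrite /stab /= => {1}<-; rewrite ltransK. Qed.

Lemma stabM A g h : stab A g -> stab A h -> stab A (g * h)%g.
Proof. by rewrite /stab /= => gA hA; rewrite ltransM hA. Qed.

Lemma stab_ltrans A g h : stab (ltrans g A) h = stab A (g^-1 * h * g)%g.
Proof.
rewrite /stab /= -mulgA !ltransM; apply/propext; split=> [->|gA].
  by rewrite ltransK.
by rewrite -[in RHS]gA ltransVK.
Qed.

Lemma finite_over_sub H X Y : X `<=` Y -> finite_over H Y -> finite_over H X.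
Proof. by move=> XY [s Ys]; exists s => x /XY /Ys. Qed.

Lemma finite_over0 H : finite_over H set0.
Proof. by exists [::]. Qed.

Lemma finite_overU H X Y :
  finite_over H X -> finite_over H Y -> finite_over H (X `|` Y).
Proof.
move=> [s Xs] [t Yt]; exists (s ++ t) => x [/Xs|/Yt] [h [g [Hh gs ->]]];
  by exists h, g; rewrite mem_cat gs ?orbT.
Qed.

Lemma finite_over_rtrans H X y :
  finite_over H X -> finite_over H [set x | X (x * y)%g].
Proof.
move=> [s Xs]; exists [seq (g * y^-1)%g | g <- s] => x /= /Xs[h [g [Hh gs xy]]].
exists h, (g * y^-1)%g; split=> //; first exact: map_f.
by rewrite mulgA -xy mulgK.
Qed.

Definition rcoset_of H g : set G := [set x | exists2 h, H h & x = (h * g)%g].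

(** Changes the subgroup: finitely many cosets of [K] cut [X] into [H]-finite pieces. *)
Lemma finite_over_rcosets H K X :
  finite_over K X -> (forall g, finite_over H (X `&` rcoset_of K g)) ->
  finite_over H X.
Proof.
move=> [s]; elim: s X => [|g s IHs] X Xs XK.
  by apply: finite_over_sub (finite_over0 H) => x /Xs[h [? []]].
apply: (@finite_over_sub _ _ ((X `&` rcoset_of K g) `|`
    (X `&` ~` rcoset_of K g))).
  by move=> x Xx; have [|] := pselect (rcoset_of K g x); [left|right].
apply: finite_overU => //; apply: IHs => [x [/Xs[k [g' []]]]|g'].
  rewrite in_cons => Kk /orP[/eqP->|g's ->{x} _]; last by exists k, g'.
  by move=> -> []; exists k.
by apply: finite_over_sub (XK g') => x [[]].
Qed.

Lemma small_ltrans g A Y : small (ltrans g A) (ltrans g Y) = small A Y.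
Proof.
suff main g' A' Y' : small A' Y' -> small (ltrans g' A') (ltrans g' Y').
  by apply/propext; split=> [/(main g^-1%g)|/main //]; rewrite !ltransK.
move=> [s Ys]; exists [seq (g' * x)%g | x <- s] => x.
rewrite ltransE => /Ys[h [y [hA ys xE]]].
exists (g' * h * g'^-1)%g, (g' * y)%g; split; [|exact: map_f|].
  by rewrite stab_ltrans !mulgA mulVg mul1g mulgVK.
by rewrite mulgA mulgVK -mulgA -xE mulVKg.
Qed.

Lemma smallC A Y : small (~` A) Y = small A Y.
Proof. by rewrite /small stabC. Qed.

(** Only one half of the symmetric difference of [A] and [A y^-1] is mentioned; the other half is a
    right translate of the set for [y^-1]. *)
Definition almost_invariant A : Prop :=
  forall y, small A [set x | A x /\ ~ A (x * y)%g].

Definition nontrivial_almost_invariant A : Prop :=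
  [/\ almost_invariant A, ~ small A A & ~ small A (~` A)].

Local Notation nai := nontrivial_almost_invariant.

Lemma naiC A : nai A -> nai (~` A).
Proof.
move=> [Aai A1 A2]; split; rewrite ?setCK ?smallC // => y.
rewrite smallC; apply: finite_over_sub (finite_over_rtrans y (Aai y^-1%g)).
by move=> x [/= Ax /contrapT Axy]; rewrite mulgK.
Qed.

Lemma nai_ltrans g A : nai A -> nai (ltrans g A).
Proof.
move=> [Aai A1 A2]; split; rewrite -?ltransC ?small_ltrans // => y.
rewrite -(small_ltrans g^-1%g) ltransK; apply: finite_over_sub (Aai y).
by move=> x; rewrite ltransE invgK /= !ltransE -mulgA !mulKg.
Qed.

Lemma nai_translates X A : nai X -> translates X A -> nai A.
Proof. by move=> nX [g [->|->]]; apply: nai_ltrans => //; apply: naiC. Qed.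

Lemma nai_neq0 A : nai A -> exists x, A x.
Proof.
move=> [_ A1 _]; apply: contrapT => nA; apply: A1.
by apply: finite_over_sub (finite_over0 _) => x Ax; case: nA; exists x.
Qed.

(* A coset [stab A * a] inside [A] but outside the finitely many covering
   [A `&` B] misses [B]; by right translation every coset [stab A * g] then
   meets [B] in a [stab B]-finite set. *)
Lemma small_sym A B : nai A -> nai B -> small A (A `&` B) -> small B (A `&` B).
Proof.
move=> [_ A1 _] [Bai _ _] smAB; apply: (finite_over_rcosets smAB) => g.
have [s ABs] := smAB.
have [a Aa aNs] : exists2 a, A a &
    ~ exists h g, [/\ stab A h, g \in s & a = (h * g)%g].
  apply: contrapT => nA; apply: A1; exists s => a Aa /=.
  by apply: contrapT => aNs; apply: nA; exists a.
apply: finite_over_sub (Bai (g^-1 * a)%g) => x [[Ax Bx] [h hA xE]].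
split=> // Bxa; apply: aNs.
have {}Bxa : B (h * a)%g by move: Bxa; rewrite xE -mulgA mulVKg.
have [|k [f [kA fs haE]]] := ABs (h * a)%g; first by split; rewrite ?(stab_mem _ hA).
exists (h^-1 * k)%g, f; split=> //; first exact: stabM (stabV hA) kA.
by rewrite -mulgA -haE mulKg.
Qed.

(* A coset [stab B * b] inside [B] meets [A] in a [stab A]-finite set, hence
   so does every coset of [stab B]. *)
Lemma small_transfer A B Y : nai A -> nai B -> small A (A `&` B) ->
  Y `<=` A -> small B Y -> small A Y.
Proof.
move=> [Aai _ _] nB smAB YA smY; apply: (finite_over_rcosets smY) => g.
have [b Bb] := nai_neq0 nB.
apply: finite_over_sub (finite_overU (Aai (g^-1 * b)%g)
  (finite_over_rtrans (g^-1 * b)%g smAB)) => x [/YA Ax [h hB xE]].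
have [Axy|nAxy] := pselect (A (x * (g^-1 * b))%g); [right|by left].
by split=> //; rewrite xE -mulgA mulVKg stab_mem.
Qed.

Definition almost_sub A B : Prop := small A (A `&` ~` B).

Lemma almost_subC A B : nai A -> nai B -> almost_sub A B ->
  almost_sub (~` B) (~` A).
Proof.
by move=> nA nB /(small_sym nA (naiC nB)); rewrite /almost_sub setCK setIC.
Qed.

Lemma almost_sub_trans B A C : nai A -> nai B -> nai C ->
  almost_sub A B -> almost_sub B C -> almost_sub A C.
Proof.
move=> nA nB nC AB BC.
apply: finite_over_sub (finite_overU AB (_ : small A (A `&` B `&` ~` C))).
  by move=> x [Ax nCx]; have [Bx|] := pselect (B x); [right|left].
apply: (small_transfer nA (naiC nB) AB); first by move=> x [[]].
by rewrite smallC; apply: finite_over_sub BC => x [[]].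
Qed.

Lemma small_setI0 A X Y : X `&` Y = set0 -> small A (X `&` Y).
Proof. by move=> ->; apply: finite_over0. Qed.

Lemma subset_setIC0 A B : A `<=` B -> A `&` ~` B = set0.
Proof. by move=> AB; rewrite -subset0 => x [/AB]. Qed.

Lemma setIC0_subset A B : A `&` ~` B = set0 -> A `<=` B.
Proof.
by move=> AB0 x Ax; apply: contrapT => nBx; have : set0 x by rewrite -AB0.
Qed.

Lemma sub_ai_le A B : A `<=` B -> ai_le A B.
Proof. by left; apply: subset_setIC0. Qed.

Lemma ai_le_refl A : ai_le A A.
Proof. exact: sub_ai_le. Qed.

Lemma ai_le_almost_sub A B : ai_le A B -> almost_sub A B.
Proof. by case=> [AB0|[]//]; exact: small_setI0. Qed.

(** In the case of [ai_le] that is not an inclusion, the part of [B] outside [A] is not small,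
    against [almost_sub B A]. *)
Lemma ai_le_sub A B : nai A -> nai B -> ai_le A B -> almost_sub B A -> A `<=` B.
Proof.
move=> nA nB [/setIC0_subset //|[_ _ nAB _]] BA; case: nAB.
by rewrite setIC -smallC; apply: small_sym nB (naiC nA) BA.
Qed.

Lemma ai_leC A B : nai A -> nai B -> ai_le A B -> ai_le (~` B) (~` A).
Proof.
move=> nA nB [AB0|[AB nAB nCAB nCACB]]; first by left; rewrite setCK setIC.
have nCB := naiC nB; have nCA := naiC nA; right; split.
- exact: almost_subC nA nB AB.
- move=> sm; apply: nCACB.
  by rewrite -smallC setIC; apply: small_sym nCB nCA sm.
- rewrite setCK smallC => sm; apply: nCAB.
  by rewrite -smallC setIC; apply: small_sym nB nCA sm.
- rewrite !setCK smallC => sm; apply: nAB.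
  by rewrite setIC; apply: small_sym nB nA sm.
Qed.

Lemma ai_le_trans B A C : nai A -> nai B -> nai C ->
  ai_le A B -> ai_le B C -> ai_le A C.
Proof.
move=> nA nB nC AB BC.
have sAB := ai_le_almost_sub AB; have sBC := ai_le_almost_sub BC.
have sAC := almost_sub_trans nA nB nC sAB sBC.
have [AC0|AC_neq0] := pselect (A `&` ~` C = set0); first by left.
(* A second small corner is absurd: the first would make [A] small, the second closes a cycle of
   almost inclusions and so forces [A] inside [C], the third would make [C^*] small. *)
right; split=> // sm.
- have [_ A1 _] := nA; apply: A1; apply: finite_over_sub (finite_overU sm sAC).
  by move=> x Ax; have [|] := pselect (C x); [left|right].
- apply: AC_neq0; apply: subset_setIC0.
  have sCA : almost_sub C A.
    by rewrite /almost_sub setIC; apply: small_sym (naiC nA) nC _; rewrite smallC.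
  apply: subset_trans (ai_le_sub nA nB AB _) (ai_le_sub nB nC BC _).
    exact: almost_sub_trans nB nC nA sBC sCA.
  exact: almost_sub_trans nC nA nB sCA sAB.
- have [_ _ C2] := nC; apply: C2; rewrite -(smallC C); rewrite -(smallC A) in sm.
  apply: finite_over_sub (finite_overU (small_sym (naiC nA) (naiC nC) sm)
    (small_sym nA (naiC nC) sAC)).
  by move=> x nCx; have [|] := pselect (A x); [right|left].
Qed.

Lemma ai_le_anti A B : nai A -> nai B -> ai_le A B -> ai_le B A -> A = B.
Proof.
move=> nA nB AB BA.
by apply/seteqP; split; apply: ai_le_sub => //; apply: ai_le_almost_sub.
Qed.

Lemma ai_le_ltrans g A B : ai_le A B -> ai_le (ltrans g A) (ltrans g B).
Proof.
rewrite /ai_le -!ltransC -!ltransI !small_ltrans => -[->|]; last by right.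
by left; apply/seteqP; split=> x //; rewrite ltransE.
Qed.

End Cosets.

(** * Nestedness, finite intervals and descending chains *)

Section Chains.
Variable G : groupType.
Implicit Types (g x : G) (A B C X Y : set G).

Local Notation nai := (@nontrivial_almost_invariant G).

Lemma translates_ltrans X g A : translates X A -> translates X (ltrans g A).
Proof. by case=> h [->|->]; exists (g * h)%g; rewrite !ltransM; [left|right]. Qed.

Lemma translatesC X A : translates X A -> translates X (~` A).
Proof. by case=> h [->|->]; exists h; rewrite -ltransC ?setCK; [right|left]. Qed.

Definition nested X : Prop := forall A B, translates X A -> translates X B ->
  [\/ A `<=` B, A `<=` ~` B, ~` A `<=` B | B `<=` A].

(** Nestedness provides an empty corner. Being small, it must be the corner of [A] and [B^*]. *)
Lemma ai_le_nested X A B : nested X -> translates X A -> translates X B ->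
  ai_le A B -> A `<=` B.
Proof.
move=> nX XA XB [/setIC0_subset //|[_ nAB nCAB nCACB]].
case: (nX A B XA XB) => // [AB|CAB|BA].
- by case: nAB; rewrite -[B]setCK; apply/small_setI0/subset_setIC0.
- by case: nCACB; apply/small_setI0/subset_setIC0.
- by case: nCAB; rewrite setIC; apply/small_setI0/subset_setIC0.
Qed.

(** The element [b^-1 g] lies in [Y] and leaves it under right multiplication by [g^-1 x]. This
    confines it to finitely many cosets of [stab Y], and its coset determines [b Y]. *)
Lemma separating_ltrans_finite Y g x : almost_invariant Y ->
  exists s : seq (set G),
    forall b, ltrans b Y g -> ~ ltrans b Y x -> ltrans b Y \in s.
Proof.
move=> /(_ (g^-1 * x)%g)[s Ys].
exists [seq ltrans (g * f^-1)%g Y | f <- s] => b; rewrite !ltransE => Yg nYx.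
have [|h [f [hY fs bE]]] := Ys (b^-1 * g)%g; first by rewrite /= -mulgA mulVKg.
suff -> : ltrans b Y = ltrans (g * f^-1)%g Y by apply: map_f.
have -> : (g * f^-1 = b * h)%g by rewrite -(mulVKg b g) bE mulgA mulgK.
by rewrite ltransM hY.
Qed.

Lemma separating_finite X g x : nai X ->
  exists s : seq (set G), forall A, translates X A -> A g -> ~ A x -> A \in s.
Proof.
move=> nX; have [aX _ _] := nX; have [aCX _ _] := naiC nX.
have [s sP] := separating_ltrans_finite g x aX.
have [t tP] := separating_ltrans_finite g x aCX.
exists (s ++ t) => A [b [->|->]] Ag Ax; rewrite mem_cat.
  by rewrite sP.
by rewrite orbC tP.
Qed.

Lemma chain_ai_le (A : nat -> set G) : (forall i, nai (A i)) ->
  (forall i, ai_le (A i.+1) (A i)) ->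
  forall i j, i <= j -> ai_le (A j) (A i).
Proof.
move=> nA dA i j /subnKC <-; elim: (j - i) => [|d IHd].
  by rewrite addn0; apply: ai_le_refl.
by rewrite addnS; apply: ai_le_trans (dA _) IHd.
Qed.

(** The recurring terms contain [g] and, lying below one of them, miss a fixed [x]; only finitely
    many translates do so. Hence one value recurs, and the chain is squeezed between its
    occurrences. *)
Lemma chain_stabilizes X (A : nat -> set G) g : nai X -> nested X ->
  (forall i, nai (A i)) -> (forall i, ai_le (A i.+1) (A i)) ->
  (forall N, exists2 i, N <= i & translates X (A i) /\ A i g) ->
  exists N, forall i, N <= i -> A i = A N.
Proof.
move=> nX neX nA dA Aio; have leA := chain_ai_le nA dA.
have [i0 _ [XAi0 _]] := Aio 0.
have [x nAx] := nai_neq0 (naiC (nA i0)).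
have [s sP] := separating_finite g x nX.
have [N|C [_ Cio]] := @infinitely_often _ s A.
  have [i] := Aio (maxn i0 N); rewrite geq_max => /andP[i0i Ni] [XAi Aig].
  exists i => //; apply: sP => // Aix; apply: nAx.
  exact: ai_le_nested neX XAi XAi0 (leA _ _ i0i) _ Aix.
have [N _ ANC] := Cio 0.
exists N => i Ni; have [j ij AjC] := Cio i.
apply: ai_le_anti => //; first exact: leA.
by rewrite ANC -AjC; apply: leA.
Qed.

Lemma dcc_minimal (V S : set (set G)) B : V `<=` nai ->
  descending_chain_condition (@ai_le G) V -> V B -> S B ->
  exists M, [/\ V M, S M, ai_le M B &
    forall M', V M' -> S M' -> ai_le M' M -> M' = M].
Proof.
move=> Vn Vdcc VB SB; apply: contrapT => noM.
pose P M := [/\ V M, S M & ai_le M B].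
have /choice[f fP] : forall M, exists M', P M -> [/\ P M', ai_le M' M & M' <> M].
  move=> M; have [[VM SM MB]|nPM] := pselect (P M); last by exists M.
  apply: contrapT => noM'; apply: noM; exists M; split=> // M' VM' SM' M'M.
  apply: contrapT => M'NM; apply: noM'; exists M' => _; split=> //.
  by split=> //; apply: ai_le_trans M'M MB; apply: Vn.
pose A i := iter i f B.
have PA i : P (A i).
  by elim: i => [|i /fP[]//]; split=> //; apply: ai_le_refl.
have [|i|N AN] := Vdcc A; first by move=> i; have [] := PA i.
  by have [] := fP _ (PA i).
by have [_ _] := fP _ (PA N); apply; apply: (AN N.+1).
Qed.

(** A translate of the lower bound of [X], or of the complement of its upper bound, lies below [E].
    Crossing is excluded because [E <= A] makes a corner small. *)
Lemma sandwiched_below X Y E A : nai X -> nai Y -> sandwiched X Y ->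
  translates X E -> translates Y A -> ai_le E A ->
  exists2 D, translates Y D & ai_le D E.
Proof.
move=> nX nY [[B [C [YB YC BX XC]]] [g EE] _ _|cr [g EE] YA EA].
  case: EE => ->; [exists (ltrans g B)|exists (ltrans g (~` C))].
  - exact: translates_ltrans.
  - exact: ai_le_ltrans.
  - exact/translates_ltrans/translatesC.
  - by apply: ai_le_ltrans; apply: ai_leC XC => //; apply: nai_translates YC.
exfalso; have [_ c2 _ c4] := cr _ (translates_ltrans g^-1%g YA).
have := ai_le_almost_sub (ai_le_ltrans g^-1%g EA).
by case: EE => ->; rewrite ltransK /almost_sub ?smallC.
Qed.

End Chains.

(** * Extending an ultrafilter over one more splitting *)

Section Extension.
Variables (G : groupType) (n : nat) (X : 'I_n -> set G).
Hypothesis naiX : forall j, nontrivial_almost_invariant (X j).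
Hypothesis nestedX : forall j, nested (X j).
Hypothesis sandwichX : satisfies_sandwiching X.

Local Notation nai := (@nontrivial_almost_invariant G).

Definition translates_below m : set (set G) :=
  \bigcup_(j in [set j : 'I_n | j < m]) translates (X j).

Lemma translates_below_nai m : translates_below m `<=` nai.
Proof. by move=> A [j _]; apply: nai_translates. Qed.

Lemma translates_belowC m A : translates_below m A -> translates_below m (~` A).
Proof. by case=> j jm XA; exists j => //; apply: translatesC. Qed.

Variables (k : 'I_n) (V : set (set G)).
Hypothesis ultraV : ultrafilter_on (translates_below k) (@ai_le G) V.
Hypothesis dccV : descending_chain_condition (@ai_le G) V.

Definition above A : Prop := exists2 B, V B & ai_le B A.

(** Containing the identity is a tie-break that respects inclusion and selects exactly one of a set
    and its complement. *)
Definition extension : set (set G) :=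
  [set A | translates_below k.+1 A /\ (above A \/ ~ above (~` A) /\ A 1%g)].

Lemma V_nai : V `<=` nai.
Proof. by have [Vs _ _] := ultraV; move=> A /Vs /translates_below_nai. Qed.

Lemma above_le A B : nai A -> nai B -> above A -> ai_le A B -> above B.
Proof.
move=> nA nB [C VC CA] AB; exists C => //.
by apply: ai_le_trans CA AB => //; apply: V_nai.
Qed.

Lemma above_old A : translates_below k A -> above A -> V A.
Proof. by have [_ _ Vup] := ultraV => kA [B VB BA]; apply: Vup BA. Qed.

(** If [B <= A] and [C <= A^*] with [B], [C] in [V], then [C <= B^*] puts [B^*] in [V] beside
    [B]. *)
Lemma aboveC A : nai A -> above A -> ~ above (~` A).
Proof.
have [Vs V1 Vup] := ultraV => nA [B VB BA] [C VC CA].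
have nB := V_nai VB; have nC := V_nai VC.
have CB : ai_le C (~` B).
  exact: ai_le_trans nC (naiC nA) (naiC nB) CA (ai_leC nB nA BA).
have [_] := V1 _ (Vs _ VB); apply; split=> //.
by apply: Vup VC _ CB; apply/translates_belowC/Vs.
Qed.

Lemma translates_belowS A : translates_below k.+1 A ->
  translates_below k A \/ translates (X k) A.
Proof.
case=> j /=; rewrite ltnS leq_eqVlt => /orP[/eqP/val_inj->|jk] XA; first by right.
by left; exists j.
Qed.

Lemma undecided A : translates_below k.+1 A -> ~ above A -> ~ above (~` A) ->
  translates (X k) A.
Proof.
move=> /translates_belowS[kA|//] nA nCA; have [_ V1 _] := ultraV.
have [[VA|VA] _] := V1 _ kA.
  by case: nA; exists A => //; apply: ai_le_refl.
by case: nCA; exists (~` A) => //; apply: ai_le_refl.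
Qed.

Lemma extension_ultrafilter :
  ultrafilter_on (translates_below k.+1) (@ai_le G) extension.
Proof.
split=> [A []//|A kA|A B [kA VA] kB AB].
  have nA := translates_below_nai kA; have kCA := translates_belowC kA.
  rewrite /extension /= setCK; split; last first.
    case=> [[_ [aA|[nCA A1]]] [_ [aCA|[naA CA1]]]] //.
    exact: aboveC nA aA aCA.
  have [aA|naA] := pselect (above A); first by left; split=> //; left.
  have [aCA|naCA] := pselect (above (~` A)); first by right; split=> //; left.
  by have [A1|nA1] := pselect (A 1%g); [left|right]; split=> //; right.
have nA := translates_below_nai kA; have nB := translates_below_nai kB.
split=> //; have [aB|naB] := pselect (above B); [by left|right].
have naA : ~ above A by move=> aA; apply: naB; apply: above_le aA AB.
have [//|[naCA A1]] := VA.
have naCB : ~ above (~` B).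
  move=> aCB; apply: naCA.
  by apply: above_le aCB _; [exact: naiC|exact: naiC|exact: ai_leC].
(* Neither [A] nor [B] is decided by [V], so both lie in [Sigma(X_k)], where the order is
   inclusion. *)
split=> //; apply: (ai_le_nested (@nestedX k) _ _ AB) => //; exact: undecided.
Qed.

(* Among the elements of [V] coming from one splitting, two distinct minimal
   ones [E], [F] satisfy [E^* <= F]; hence [E] or [E^*] lies below every term
   of a chain of elements above [V]. *)
Lemma chain_lower_bound (A : nat -> set G) : (forall i, nai (A i)) ->
  (forall i, ai_le (A i.+1) (A i)) -> (forall i, above (A i)) ->
  exists j, exists2 E, translates (X j) E & forall i, ai_le E (A i).
Proof.
move=> nA dA aA; have leA := chain_ai_le nA dA.
have [Vs V1 Vup] := ultraV.
have /choice[f fP] : forall i, exists j : 'I_n,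
    exists B, [/\ V B, translates (X j) B & ai_le B (A i)].
  by move=> i; have [B VB BA] := aA i; have [j _ XB] := Vs _ VB; exists j, B.
have [N|j [_ jio]] := @infinitely_often _ (enum 'I_n) f.
  by exists N; rewrite ?mem_enum.
have minP i : exists E, [/\ V E, translates (X j) E, ai_le E (A i) &
    forall F, V F -> translates (X j) F -> ai_le F E -> F = E].
  have [i' ii' fi'] := jio i; have [B [VB XB BA]] := fP i'.
  rewrite fi' in XB; have [E [VE XE EB Emin]] := dcc_minimal V_nai dccV VB XB.
  have nE := V_nai VE; have nB := V_nai VB.
  exists E; split=> //; apply: (ai_le_trans nE nB (nA i) EB).
  exact: ai_le_trans nB (nA i') (nA i) BA (leA _ _ ii').
have [E [VE XE _ Emin]] := minP 0.
have nE := V_nai VE; exists j.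
have [EA|/existsNP[i0 nEA]] := pselect (forall i, ai_le E (A i)); first by exists E.
exists (~` E); first exact: translatesC.
have nCE := naiC nE.
(* Past [i0], minimality excludes that one of [E], [F] contains the other, and [V] cannot hold both
   [F] and [F^*]; what remains is [E^*] inside [F]. *)
have late i : i0 <= i -> ai_le (~` E) (A i).
  move=> i0i; have nEAi : ~ ai_le E (A i).
    by move=> EAi; apply: nEA; apply: ai_le_trans EAi (leA _ _ i0i).
  have [F [VF XF FA Fmin]] := minP i; have nF := V_nai VF.
  have [EF|EF|EF|FE] := nestedX XE XF.
  - by case: nEAi; rewrite (Fmin E) //; apply: sub_ai_le.
  - have [_] := V1 _ (Vs _ VF); case; split=> //.
    by apply: Vup VE _ (sub_ai_le EF); apply/translates_belowC/Vs.
  - exact: ai_le_trans nCE nF (nA i) (sub_ai_le EF) FA.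
  - by case: nEAi; rewrite -(Emin F) //; apply: sub_ai_le.
move=> i; have [i0i|/ltnW ii0] := leqP i0 i; first exact: late.
exact: ai_le_trans nCE (nA i0) (nA i) (late _ (leqnn _)) (leA _ _ ii0).
Qed.

Lemma extension_dcc : descending_chain_condition (@ai_le G) extension.
Proof.
move=> A VA dA.
have kA i : translates_below k.+1 (A i) by have [] := VA i.
have nA i : nai (A i) := translates_below_nai (kA i).
have leA := chain_ai_le nA dA.
have [Xio|/existsNP[N nXA]] :=
    pselect (forall N, exists2 i, N <= i & translates (X k) (A i)); last first.
  have VAN i : V (A (N + i)).
    have nXi : ~ translates (X k) (A (N + i)).
      by move=> XA; apply: nXA; exists (N + i); rewrite ?leq_addr.
    have [kAi|//] := translates_belowS (kA (N + i)).
    have [_ [aA|[nCA _]]] := VA (N + i); first exact: above_old.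
    by apply: above_old => //; apply: contrapT => naA; apply/nXi/undecided.
  have [|M AM] := dccV VAN; first by move=> i; rewrite addnS.
  exists (N + M) => i NMi.
  have Ni : N <= i by apply: leq_trans NMi; apply: leq_addr.
  by rewrite -(AM (i - N)) ?subnKC // leq_subRL.
have [X1io|/existsNP[N nXA]] := pselect (forall N,
    exists2 i, N <= i & translates (X k) (A i) /\ A i 1%g).
  exact: chain_stabilizes X1io.
have aA i : above (A i).
  (* A late term in [Sigma(X_k)] misses the identity, so it was chosen for lying above an element of
     [V]; the terms before it inherit this. *)
  have [j] := Xio (maxn i N); rewrite geq_max => /andP[ij Nj] XAj.
  apply: above_le (leA _ _ ij) => //; have [_ [//|[_ A1]]] := VA j.
  by case: nXA; exists j.
have [j [E XE EA]] := chain_lower_bound nA dA aA.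
have nE := nai_translates (naiX j) XE.
have [i0 _ XAi0] := Xio 0.
have [D XD DE] :=
  sandwiched_below (naiX j) (naiX k) (sandwichX j k) XE XAi0 (EA i0).
have nD := nai_translates (naiX k) XD; have [g Dg] := nai_neq0 nD.
(* A point [g] of [D] lies in every term from [Sigma(X_k)] and takes the place of the identity. *)
apply: (@chain_stabilizes _ (X k) A g) => // M.
have [i Mi XAi] := Xio M; exists i => //; split=> //.
apply: (ai_le_nested (@nestedX k) XD XAi _ Dg).
exact: ai_le_trans nD nE (nA i) DE (EA i).
Qed.

End Extension.

Lemma ultrafilter_dcc_exists (G : groupType) (n : nat) (X : 'I_n -> set G) :
  (forall j, nontrivial_almost_invariant (X j)) -> (forall j, nested (X j)) ->
  satisfies_sandwiching X -> exists V : set (set G),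
    ultrafilter_on (\bigcup_(j in [set: 'I_n]) translates (X j)) (@ai_le G) V /\
    descending_chain_condition (@ai_le G) V.
Proof.
move=> nX neX sX.
have -> : \bigcup_(j in [set: 'I_n]) translates (X j) = translates_below X n.
  by congr bigcup; apply/seteqP; split=> j //= _; apply: ltn_ord.
have: forall m, m <= n -> exists V : set (set G),
    ultrafilter_on (translates_below X m) (@ai_le G) V /\
    descending_chain_condition (@ai_le G) V; last by apply.
elim=> [_|m IHm mn].
  exists set0; split; last by move=> A /(_ 0).
  by split=> // A [].
have [V [uV dV]] := IHm (ltnW mn).
exists (extension X (Ordinal mn) V); split.
  exact: extension_ultrafilter.
exact: extension_dcc.
Qed.

(** For [y] in [X], all [g^-m y] lie in [X]. If [X] were small, two of them would share a coset of
    [stab X], so a positive power of [g] would stabilize [X] and squeeze [g X] into [X]. *)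
Lemma increasing_not_small (G : groupType) (X : set G) g :
  X `<=` ltrans g X -> ltrans g X <> X -> ~ small X X.
Proof.
move=> XgX gXNX [s Xs].
have incX m : X `<=` ltrans (g ^+ m)%g X.
  elim: m => [|m IHm]; first by rewrite expg0 ltrans1.
  by rewrite expgS ltransM; apply: subset_trans XgX (ltransS IHm).
have [y Xy] : exists y, X y.
  apply: contrapT => nX; apply: gXNX; apply/seteqP; split=> x //.
    by rewrite ltransE => Xx; case: nX; exists (g^-1 * x)%g.
  by move=> Xx; case: nX; exists x.
have /choice[f fP] : forall m, exists t,
    t \in s /\ exists2 h, stab X h & ((g ^+ m)^-1 * y = h * t)%g.
  move=> m; have [|h [t [hX ts E]]] := Xs ((g ^+ m)^-1 * y)%g.
    by rewrite -ltransE; apply: incX.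
  by exists t; split=> //; exists h.
have [N|t [_ tio]] := @infinitely_often _ s f.
  by exists N => //; have [] := fP N.
have [m _ fm] := tio 0; have [m' mm' fm'] := tio m.+1.
have [[_ [h hX hE]] [_ [h' hX' hE']]] := (fP m, fP m').
have gX : stab X (g ^+ (m' - m))%g.
  rewrite -[(g ^+ _)%g]invgK; apply: stabV.
  suff -> : ((g ^+ (m' - m))^-1 = h' * h^-1)%g by apply/stabM/stabV.
  apply: (@mulIg _ (h * t)%g); rewrite -[RHS]mulgA mulKg -{1}fm -hE -fm' -hE'.
  by rewrite mulgA -invgM -expgnDr subnKC // ltnW.
apply/gXNX/seteqP; split=> //; rewrite -[X in _ `<=` X]gX.
rewrite -(subnSK mm') expgS ltransM; exact/ltransS/incX.
Qed.

(** * Half-trees and the action on them *)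

Section TreeConnectivity.
Variables (G : groupType) (T : Gtree G).
Implicit Types (e f : vertex T * vertex T) (u v w x y : vertex T) (g : G).

Definition conn e u w : Prop :=
  exists2 p, path (adj_minus e) u p & last u p = w.

Lemma conn_refl e u : conn e u u.
Proof. by exists [::]. Qed.

Lemma conn_step e u x y : conn e u x -> adj_minus e x y -> conn e u y.
Proof.
by move=> [p up <-] xy; exists (rcons p y); rewrite ?last_rcons // rcons_path up.
Qed.

Lemma conn_trans e u v w : conn e u v -> conn e v w -> conn e u w.
Proof.
move=> [p up <-] [q vq <-]; exists (p ++ q); last by rewrite last_cat.
by rewrite cat_path up.
Qed.

Lemma conn_ind e u (P : vertex T -> Prop) : P u ->
  (forall x y, conn e u x -> P x -> adj_minus e x y -> P y) ->
  forall w, conn e u w -> P w.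
Proof.
move=> Pu IH w [p up <-]; elim/last_ind: p up => [|p y IHp] //=.
rewrite rcons_path last_rcons => /andP[up py].
by apply: (IH _ _ _ (IHp up) py); exists p.
Qed.

Lemma adj_minus_sym e : symmetric (adj_minus e).
Proof.
by move=> x y; rewrite /adj_minus adj_sym; congr (_ && _); rewrite andbC.
Qed.

Lemma conn_sym e u w : conn e u w -> conn e w u.
Proof.
apply: (conn_ind (P := (conn e)^~ u)) => [|x y _ wx xy]; first exact: conn_refl.
apply: conn_trans wx; apply: conn_step (conn_refl _ _) _.
by rewrite adj_minus_sym.
Qed.

Lemma adj_minus_rev e x y : adj_minus (e.2, e.1) x y = adj_minus e x y.
Proof.
case: e => a b; rewrite /adj_minus /= !xpair_eqE andbC [in RHS]andbC.
by congr (_ && _); rewrite andbC; congr (~~ _ && ~~ _); rewrite andbC.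
Qed.

Lemma conn_rev e u w : conn (e.2, e.1) u w -> conn e u w.
Proof.
apply: (conn_ind (P := conn e u)) => [|x y _ ux xy]; first exact: conn_refl.
by apply: conn_step ux _; rewrite -adj_minus_rev.
Qed.

Lemma adj_ind u (P : vertex T -> Prop) : P u ->
  (forall x y, P x -> adj T x y -> P y) -> forall w, P w.
Proof.
move=> Pu IH w; have [p up <-] := tree_connected u w.
elim/last_ind: p up => [|p y IHp] //=.
by rewrite rcons_path last_rcons => /andP[up]; apply: IH; apply: IHp.
Qed.

Lemma adj_neq x y : adj T x y -> x <> y.
Proof. by move=> xy xE; move: xy; rewrite xE adj_irrefl. Qed.

(** A simple path between the ends of [e] closes up with [e] to a cycle. Acyclicity leaves only a
    path of one step, which is [e] itself. *)
Lemma edge_cuts e : adj T e.1 e.2 -> ~ conn e e.1 e.2.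
Proof.
move=> e12 [p ep]; case: (shortenP ep) => q eq uq _ qE.
have cyc : ucycle (adj T) (e.1 :: q).
  rewrite /ucycle uq andbT /= rcons_path qE adj_sym e12 andbT.
  by apply: sub_path eq => x y /and3P[].
move: (tree_acyclic cyc) => /=; case: q qE eq {uq cyc} => [|y [|z q]] //=.
  by move=> eE; case: (adj_neq e12).
by move=> ->; rewrite /adj_minus -surjective_pairing eqxx andbF.
Qed.

Lemma edge_sides e w : conn e e.1 w \/ conn e e.2 w.
Proof.
apply: (adj_ind (u := e.1) (P := fun w => conn e e.1 w \/ conn e e.2 w)).
  by left; apply: conn_refl.
move=> x y exy xy.
have [<-|xyNe] := eqVneq (x, y) e; first by right; apply: conn_refl.
have [<-|yxNe] := eqVneq (y, x) e; first by left; apply: conn_refl.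
have xye : adj_minus e x y by rewrite /adj_minus xy xyNe yxNe.
by case: exy => ex; [left|right]; apply: conn_step ex xye.
Qed.

(* The removal of [f] does not matter for a component that misses an end of
   [f]. *)
Lemma conn_avoid e f u w : ~ conn e u f.1 \/ ~ conn e u f.2 ->
  conn e u w -> conn f u w.
Proof.
move=> avoid; apply: (conn_ind (P := conn f u)) => [|x y ux fux xy].
  exact: conn_refl.
have uy := conn_step ux xy; apply: conn_step fux _.
have /and3P[xyT _ _] := xy; rewrite /adj_minus xyT /=.
by apply/andP; split; apply/eqP => fE; move: avoid; rewrite -fE /=; case.
Qed.

(** Unless [e] and [f] have the same ends, each lies on one side of the other; the two choices of
    side give the four alternatives. *)
Lemma half_trees_nested e f : adj T e.1 e.2 -> adj T f.1 f.2 ->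
  [\/ forall w, conn e e.1 w -> conn f f.1 w,
      forall w, conn e e.1 w -> ~ conn f f.1 w,
      forall w, ~ conn e e.1 w -> conn f f.1 w |
      forall w, conn f f.1 w -> conn e e.1 w].
Proof.
move=> eT fT; have eC := edge_cuts eT.
have [->|fNe] := eqVneq f e; first by constructor 1.
have [->|fNe'] := eqVneq f (e.2, e.1).
  constructor 2 => w e1w /conn_rev e2w; apply: eC.
  exact: conn_trans e1w (conn_sym e2w).
have f12 : adj_minus e f.1 f.2.
  rewrite /adj_minus fT -surjective_pairing fNe /=.
  by apply: contraNneq fNe' => <-; rewrite -surjective_pairing.
have e12 : adj_minus f e.1 e.2.
  rewrite /adj_minus eT -surjective_pairing eq_sym fNe /=.
  by rewrite eq_sym.
have [P|P] := pselect (conn e e.1 f.1); have [Q|Q] := pselect (conn f f.1 e.1).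
- constructor 3 => w; have [//|e2w _] := edge_sides e w.
  apply: conn_trans (conn_step Q e12) (conn_avoid _ e2w); left=> e2f.
  exact: eC (conn_trans P (conn_sym e2f)).
- constructor 4 => w /(conn_avoid (f := e)) fw; apply: conn_trans P (fw _).
  by left.
- constructor 1 => w /(conn_avoid (f := f)) ew; apply: conn_trans Q (ew _).
  by left.
- constructor 2 => w ew fw; apply: Q; apply: conn_trans fw (conn_sym _).
  by apply: conn_avoid ew; left.
Qed.

(** The half-tree at [e.1] misses [e.2], so it survives the removal of the next edge, and [e]
    attaches it to [e.2]. *)
Lemma half_tree_sub e z : adj T e.1 e.2 -> adj T e.2 z -> z <> e.1 ->
  forall w, conn e e.1 w -> conn (e.2, z) e.2 w.
Proof.
move=> eT ezT zNe w e1w; apply: (@conn_trans _ _ e.1).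
  apply: conn_step (conn_refl _ _) _; rewrite /adj_minus adj_sym eT /=.
  rewrite !xpair_eqE eqxx /= eq_sym (introF eqP zNe) /=.
  by apply/negP => /andP[/eqP/(adj_neq eT)].
by apply: conn_avoid e1w; left; apply: edge_cuts.
Qed.

Definition gact_edge g e := (gact T g e.1, gact T g e.2).

Lemma gactK g v : gact T g^-1 (gact T g v) = v.
Proof. by rewrite -gactM mulVg gact1. Qed.

Lemma gact_inj g : injective (gact T g).
Proof. exact: can_inj (gactK g). Qed.

Lemma gact_edgeM g h e : gact_edge (g * h)%g e = gact_edge g (gact_edge h e).
Proof. by rewrite /gact_edge !gactM. Qed.

Lemma gact_edgeK g e : gact_edge g^-1 (gact_edge g e) = e.
Proof. by rewrite /gact_edge !gactK -surjective_pairing. Qed.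

Lemma conn_gact g e u w :
  conn (gact_edge g e) (gact T g u) (gact T g w) = conn e u w.
Proof.
suff main g' e' u' w' : conn e' u' w' ->
    conn (gact_edge g' e') (gact T g' u') (gact T g' w').
  by apply/propext; split=> [/(main g^-1%g)|/main //]; rewrite gact_edgeK !gactK.
apply: (conn_ind (P := fun w =>
  conn (gact_edge g' e') (gact T g' u') (gact T g' w))) => [|x y _ ux].
  exact: conn_refl.
move=> /and3P[xy xyN yxN].
apply: conn_step ux _; rewrite /adj_minus gact_adj xy /=.
rewrite !xpair_eqE !(inj_eq (@gact_inj g')).
by move: xyN yxN; case: (e') => a b; rewrite !xpair_eqE => -> ->.
Qed.

Lemma finite_over_edge_fiber e f :
  finite_over (edge_stab e) [set g | gact_edge g f = e].
Proof.
have [[g0 g0E]|nE] := pselect (exists g, gact_edge g f = e); last first.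
  by exists [::] => g gE; case: nE; exists g.
exists [:: g0] => g gE; exists (g * g0^-1)%g, g0.
split; rewrite ?mem_head ?mulgVK //.
have: gact_edge (g * g0^-1)%g e = e by rewrite gact_edgeM -{1}g0E gact_edgeK.
by rewrite {2}[e]surjective_pairing => -[].
Qed.

(* The path from [u] to [w] has finitely many edges, and one of them is moved
   to [e] by every [g] such that [e] separates [g u] from [g w]. *)
Lemma half_tree_almost_invariant e u w : finite_over (edge_stab e)
  [set g | conn e e.1 (gact T g u) /\ ~ conn e e.1 (gact T g w)].
Proof.
apply: (adj_ind (u := u) (P := fun w => finite_over (edge_stab e)
  [set g | conn e e.1 (gact T g u) /\ ~ conn e e.1 (gact T g w)])) => [|x y].
  by apply: finite_over_sub (finite_over0 _) => g [].
move=> xfin xy; apply: finite_over_sub (finite_overU xfin (finite_overU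
  (finite_over_edge_fiber e (x, y)) (finite_over_edge_fiber e (y, x)))).
move=> g [gu gy].
have [gx|] := pselect (conn e e.1 (gact T g x)); last by left.
have [xyE|xyN] := eqVneq (gact_edge g (x, y)) e; first by right; left.
have [yxE|yxN] := eqVneq (gact_edge g (y, x)) e; first by right; right.
case: gy; apply: conn_step gx _.
by apply/and3P; split; rewrite ?gact_adj.
Qed.

(* If an end [b] of an edge [ab] is a leaf then so is one end of every edge,
   and the tree is a star centred at [a]. *)
Lemma leaf_global_fixed_point a b : one_edge_orbit T -> adj T a b ->
  (forall z, adj T b z -> z = a) -> has_global_fixed_point T.
Proof.
move=> [_ orb] ab leaf_b; exists a => g.
have leaf_gb h z : adj T (gact T h b) z -> z = gact T h a.
  move=> bz; rewrite -[z](gactK h^-1) invgK; congr (gact T h _); apply: leaf_b.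
  by rewrite -(gact_adj h) -gactM mulgV gact1.
have leaf_nbr z : adj T a z -> forall y, adj T z y -> y = a.
  move=> az y zy; have [h [[hE1 hE2]|[hE1 hE2]]] := orb _ _ _ _ ab az.
    by rewrite -hE1; apply: (leaf_gb h); rewrite hE2.
  have ha : forall w, adj T a w -> w = z.
    by move=> w; rewrite -hE2 => /leaf_gb ->; rewrite hE1.
  by apply: leaf_b; rewrite (ha b ab).
have star w : w = a \/ adj T a w.
  apply: (adj_ind (u := a) (P := fun w => w = a \/ adj T a w)) => [|x y [->|ax] xy]; first by left.
    by right.
  by left; apply: leaf_nbr ax _ xy.
(* If [g] moved [a], then [g a] would be a neighbour of [a] with no other neighbour, so [g] would
   swap [a] and [b]. *)
have [//|aga] := star (gact T g a).
have gbE : gact T g b = a by apply: leaf_nbr aga _ _; rewrite gact_adj.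
have gaE : gact T g a = b.
  by apply/esym/(leaf_gb g); rewrite gbE.
by case: (no_inversion (g := g) ab).
Qed.

(* Two consecutive edges in the same orbit with coherent orientations give a
   hyperbolic element. Otherwise every vertex is a source or a sink, and a
   translate of [e] coherent with it is found two edges further, by following
   an edge into [e.2] backwards and then an edge out of its origin. *)
Lemma hyperbolic_translate e : one_edge_orbit T -> ~ has_global_fixed_point T ->
  adj T e.1 e.2 -> exists g, gact_edge g e <> e /\
    forall w, conn e e.1 w -> conn (gact_edge g e) (gact T g e.1) w.
Proof.
move=> orb nofix eT.
have [z [ez zNe]] : exists z, adj T e.2 z /\ z <> e.1.
  apply: contrapT => nz; apply: nofix; apply: leaf_global_fixed_point eT _ => //.
  by move=> z ez; apply: contrapT => zNe; apply: nz; exists z.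
have [z' [ez' zNe']] : exists z, adj T e.1 z /\ z <> e.2.
  apply: contrapT => nz; apply: nofix.
  apply: (@leaf_global_fixed_point e.2 e.1) => //; first by rewrite adj_sym.
  by move=> z' ez'; apply: contrapT => zNe'; apply: nz; exists z'.
have [_ orbit_edge] := orb.
have [g [[g1 g2]|[g1 g2]]] := orbit_edge _ _ _ _ eT ez.
  exists g; rewrite /gact_edge g1 g2; split; last exact: half_tree_sub.
  by move=> /(congr1 fst)/esym/(adj_neq eT).
have [h [[h1 h2]|[h1 h2]]] := orbit_edge _ _ _ _ eT ez'; last first.
  have ze' : adj T z' e.1 by rewrite adj_sym.
  exists h^-1%g; split=> [hE|w].
    have := congr1 (gact_edge h) hE; rewrite -{1}[h]invgK gact_edgeK.
    by rewrite /gact_edge h1 h2 => /(congr1 snd)/esym/(adj_neq eT).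
  rewrite -(conn_gact h) /gact_edge h1 h2 => ew.
  rewrite -[w](gactK h) conn_gact [e]surjective_pairing.
  by apply: (@half_tree_sub (z', e.1)) ew => //= /esym.
have ge1 : gact T g e.1 = z by [].
have ge : adj T z (gact T g z') by rewrite -ge1 gact_adj.
have gzN : gact T g z' <> e.2 by rewrite -g2 => /gact_inj.
(* [g * h] moves [e] to the edge from [z] to [g z'], and the path [e.1], [e.2], [z], [g z'] never
   backtracks. *)
exists (g * h)%g; rewrite gactM h1 ge1 gact_edgeM /gact_edge /= h1 h2 ge1.
split=> [/(congr1 fst)//|w /(half_tree_sub eT ez zNe)].
exact: (@half_tree_sub (e.2, z)).
Qed.

End TreeConnectivity.

(** * Almost invariant sets arising from a splitting *)

Section ArisingSets.
Variables (G : groupType) (T : splitting G) (H X : set G).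
Hypothesis arisesX : almost_invariant_from T H X.

(** Membership of [x] in [g X] says that [x v] lies in the initial half-tree of [g e], so nestedness
    comes from half-trees; complements only permute the alternatives. *)
Lemma arising_nested : nested X.
Proof.
have [v [e [eT XE _ _]]] := arisesX.
have ltransXE g x :
    ltrans g X x = conn (gact_edge g e) (gact T g e.1) (gact T x v).
  by rewrite ltransE XE -[RHS](conn_gact g^-1) gact_edgeK gactK -gactM.
have nestedXX g h : [\/ ltrans g X `<=` ltrans h X, ltrans g X `<=` ~` ltrans h X,
    ~` ltrans g X `<=` ltrans h X | ltrans h X `<=` ltrans g X].
  have [||P|P|P|P] := @half_trees_nested _ T (gact_edge g e) (gact_edge h e);
    rewrite /= ?gact_adj //;
    [constructor 1|constructor 2|constructor 3|constructor 4];
    by move=> x; rewrite /setC /= !ltransXE; apply: P.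
have subC (A B : set G) : ~` A `<=` B -> ~` B `<=` A.
  by move=> AB x nBx; apply: contrapT => /AB.
have subC' (A B : set G) : A `<=` ~` B -> B `<=` ~` A by move=> AB x Bx /AB.
move=> _ _ [g [->|->]] [h [->|->]]; have := nestedXX g h; rewrite ?ltransC ?setCK //.
- by case=> P; [constructor 2|constructor 1|constructor 4; exact: subC|
    constructor 3; exact: subsetC].
- by case=> P; [constructor 3|constructor 4; exact: subC'|constructor 1|
    constructor 2; exact: subsetC].
- by case=> P; [constructor 4; exact: subsetC|constructor 3|constructor 2|
    constructor 1; exact: subsetC].
Qed.

Lemma arising_almost_invariant : almost_invariant X.
Proof.
have [v [e [eT XE HE HX]]] := arisesX; move=> y; rewrite /small -HX HE.
apply: finite_over_sub (half_tree_almost_invariant e v (gact T y v)) => x.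
by rewrite XE /= gactM.
Qed.

Lemma arising_nontrivial : nontrivial_almost_invariant X.
Proof.
have [v [e [eT XE HE HX]]] := arisesX.
have [g [geNe eg]] := hyperbolic_translate (@splitting_one_edge _ T)
  (@splitting_no_fixed_point _ T) eT.
have XgX : X `<=` ltrans g X.
  move=> x; rewrite ltransE XE => /= /eg.
  by rewrite -{1}[x](mulVKg g) gactM conn_gact.
(* The stabilizer of [X] is that of [e], and [g] moves [e]. *)
have gXNX : ltrans g X <> X.
  move=> gX; have : stab X g by [].
  by rewrite -HX HE => -[ge1 ge2]; apply: geNe;
    rewrite /gact_edge ge1 ge2 -surjective_pairing.
split; first exact: arising_almost_invariant.
  exact: increasing_not_small XgX gXNX.
rewrite -smallC; apply: (@increasing_not_small _ _ g^-1%g) => [|gCX].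
  by rewrite -{1}[X](ltransK g) -ltransC; apply/ltransS/subsetC.
apply: gXNX; move: gCX; rewrite ltransC => /(congr1 setC); rewrite !setCK.
by move=> {1}<-; rewrite ltransVK.
Qed.

End ArisingSets.

Theorem theorem8p9 (G : groupType) (n : nat) (sigma : 'I_n -> splitting G)
    (H X : 'I_n -> set G)
    (noniso : forall j k, j <> k -> ~ isomorphic (sigma j) (sigma k))
    (arises : forall j, almost_invariant_from (sigma j) (H j) (X j))
    (sandwich : satisfies_sandwiching X) :
  let Sigma := \bigcup_(j in [set: 'I_n]) translates (X j) in
  exists V : set (set G),
    ultrafilter_on Sigma (@ai_le G) V /\
    descending_chain_condition (@ai_le G) V.
Proof.
apply: ultrafilter_dcc_exists => // j.
  exact: arising_nontrivial (arises j).
exact: arising_nested (arises j).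
Qed.
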